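(* Let $F:B^{s_D}_{p_D}\to L_2$ be linear and continuous, where $s_D\in\mathbb{R}$, $p_D>1$, and suppose that the range of its adjoint is $\operatorname{rg}F^*=B^{s_G}_{p_G}\subset (B^{s_D}_{p_D})^*=B^{-s_D}_{p_D^*}$. Let $v\in L_2$ and $Fu^\dagger=v$ with $u^\dagger\in B^{s_S}_{p_S}\subset B^{s_D}_{p_D}$, where $p_S\le p_G$. For $\delta>0$ let $v^\delta\in L_2$ satisfy $\|v-v^\delta\|_{L_2}\le\delta$, and let $\alpha=\alpha(\delta)>0$ satisfy $\alpha\asymp\delta$. Let $$p_R=\frac{p_S+p_G}{p_G},\qquad s_R\le\frac{p_Ss_S-p_Gs_G}{p_S+p_G}.$$ Then for each choice of minimizers $u^{\alpha,\delta}\in B^{s_D}_{p_D}$ of the Tikhonov functional $$T_\alpha(u)=\|Fu-v^\delta\|_{L_2}^2+\alpha\|u\|_{B^{s_R}_{p_R}}^{p_R},\qquad u\in B^{s_D}_{p_D},$$ one has the convergence rate $$\|u^{\alpha,\delta}-u^\dagger\|_{H^\sigma}=\mathcal{O}(\sqrt\delta)\quad\text{as }\delta\to0,\qquad\text{where } \sigma:=s_R+d\Big(\frac12-\frac1{p_R}\Big).$$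
   Context: All function spaces consist of functions or distributions on a fixed set $\Omega\subset\mathbb{R}^d$; $L_2=L_2(\Omega)$. $B^s_p:=B^s_{p,p}$ denotes the Besov space with smoothness $s\in\mathbb{R}$ and both integrability indices equal to $p>0$; $H^s=B^s_{2}$ is the Sobolev space. A wavelet basis $\{\psi_\lambda\}_{\lambda\in\Lambda}$, orthonormal in $L_2$ (with $|\lambda|$ the scale of the index $\lambda$), is fixed which characterizes all Besov spaces under consideration, and $B^s_p$ is equipped with the (equivalent) norm (quasi-norm if $p<1$) $$\|u\|_{B^s_p}^p=\sum_{\lambda\in\Lambda}2^{p(s+d(\frac12-\frac1p))|\lambda|}|u_\lambda|^p,\qquad u_\lambda=\langle u,\psi_\lambda\rangle .$$ Inclusion $\subset$ between Besov spaces means continuous embedding; $B^{s_1}_{p_1}\subset B^{s_2}_{p_2}$ holds if $s_1-\frac d{p_1}>s_2-\frac d{p_2}$ and $p_1\le p_2$. The conjugate exponent $p^*$ is defined by $\frac1p+\frac1{p^*}=1$, and $(B^s_p)^*$ is identified with $B^{-s}_{p^*}$ through the $L_2$ duality pairing. For $u\in B^{s_D}_{p_D}\setminus B^{s_R}_{p_R}$ one sets $\|u\|_{B^{s_R}_{p_R}}=\infty$. $A\asymp B$ means there are constants $c,C>0$ (here independent of $\delta$) with $cA\le B\le CA$. *)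

(* Defs.v *)
From HB Require Import structures.
From mathcomp Require Import all_boot all_order all_algebra.
From mathcomp Require Import all_classical all_reals all_analysis.

Set Implicit Arguments.
Unset Strict Implicit.
Unset Printing Implicit Defensive.

Import Order.TTheory GRing.Theory Num.Theory.
Import numFieldNormedType.Exports.

Local Open Scope classical_set_scope.
Local Open Scope ring_scope.

(* R^d with the product of the Borel sigma-algebras *)
Definition Rn (R : realType) (d : nat) := d.-tuple (measurableTypeR R).

(* The volume of half-open boxes determines a measure on the Borel sets of R^d
   uniquely, so this pins down the d-dimensional Lebesgue measure, which the
   library provides for d = 1 only. *)
Definition is_lebesgue (R : realType) (d : nat)
    (leb : {measure set (Rn R d) -> \bar R}) : Prop :=
  forall a b : Rn R d, (forall i, tnth a i <= tnth b i) ->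
    leb [set x : Rn R d | forall i, tnth a i < tnth x i <= tnth b i] =
    (\prod_(i < d) (tnth b i - tnth a i))%:E.

Lemma le1_2e (R : realType) : (1 <= 2%:E :> \bar R)%E.
Proof. by rewrite lee_fin ler1n. Qed.

Section L2.
Context (R : realType) (d : nat) (leb : {measure set (Rn R d) -> \bar R})
  (Omega : set (Rn R d)) (mOmega : measurable Omega).

(* Square-integrable functions for Lebesgue measure restricted to Omega.  Elements
   of L_2(Omega) are classes of such functions: equality in L_2 is L2eq, never
   Leibniz equality. *)
Definition L2 := LfunType (mrestr leb mOmega) (le1_2e R).

Definition L2eq (f g : L2) : Prop :=
  {ae mrestr leb mOmega, forall x, f x = g x}.

Definition L2norm (f : L2) : \bar R := 'N[mrestr leb mOmega]_(2%:E)[EFin \o f]%E.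

Definition L2inner (f g : L2) : R := \int[mrestr leb mOmega]_x (f x * g x).

End L2.

Arguments L2 {R d} leb {Omega} mOmega.
Arguments L2norm {R d leb Omega mOmega} f%_R.

(* The functions and distributions on Omega that make up the function spaces,
   together with a wavelet basis.  On domains the wavelets need not be test
   functions, so <u, psi_l> is not an instance of the distributional pairing;
   the ambient space is therefore kept abstract, with a coefficient map that
   determines its elements and extends the L_2 inner product. *)
Record wavelet_basis (R : realType) (d : nat)
    (leb : {measure set (Rn R d) -> \bar R}) (Omega : set (Rn R d))
    (mOmega : measurable Omega) := WaveletBasis {
  dist : lmodType R;
  dist_of : L2 leb mOmega -> dist;
  windex : countType;
  scale : windex -> nat;
  psi : windex -> L2 leb mOmega;
  psi_orthonormal : forall l m, L2inner (psi l) (psi m) = (l == m)%:R;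
  (* the closed linear span of the wavelets is L_2 *)
  psi_total : forall (f : L2 leb mOmega) (e : R), 0 < e ->
    exists (s : seq windex) (c : windex -> R),
      (L2norm (f - \sum_(l <- s) c l *: psi l) < e%:E)%E;
  coef : dist -> windex -> R;
  coef_linear : forall (a : R) (u v : dist) l,
    coef (a *: u + v) l = a * coef u l + coef v l;
  coef_inj : injective coef;
  coef_dist_of : forall f l, coef (dist_of f) l = L2inner f (psi l)
}.

Section besov.
Context (R : realType) (d : nat) (leb : {measure set (Rn R d) -> \bar R})
  (Omega : set (Rn R d)) (mOmega : measurable Omega)
  (W : wavelet_basis leb mOmega).

Definition besov_seq_norm (s p : R) (c : windex W -> R) : \bar R :=
  ((\esum_(l in [set: windex W])
     (2 `^ (p * (s + d%:R * (2^-1 - p^-1)) * (scale l)%:R)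
        * `|c l| `^ p)%:E) `^ p^-1)%E.

(* takes the value +oo exactly off B^s_p *)
Definition besov_norm (s p : R) (u : dist W) : \bar R :=
  besov_seq_norm s p (coef u).

Arguments besov_norm s%_R p%_R u%_R.

Definition besov (s p : R) : set (dist W) :=
  [set u | (besov_norm s p u < +oo)%E].

Definition sobolev_norm (s : R) (u : dist W) : \bar R := besov_norm s 2 u.

(* The basis characterizes B^s_p: the coefficient map, which is injective, maps
   B^s_p onto the whole weighted sequence space. *)
Definition characterizes (s p : R) : Prop :=
  forall c : windex W -> R, (besov_seq_norm s p c < +oo)%E ->
    exists u : dist W, coef u = c.

(* continuous embedding of B^s1_p1 in B^s2_p2 *)
Definition besov_embedded (s1 p1 s2 p2 : R) : Prop :=
  exists C : R, forall u, besov s1 p1 u ->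
    (besov_norm s2 p2 u <= C%:E * besov_norm s1 p1 u)%E.

(* The L_2 duality pairing in wavelet coordinates, sum_l g_l u_l; for g in
   B^{-s}_{p*} and u in B^s_p, p > 1, the series converges absolutely. *)
Definition duality (g u : dist W) : R :=
  let t := fun l => (coef g l * coef u l)%:E in
  fine (esum [set: windex W] t^\+ - esum [set: windex W] t^\-)%E.

Definition linear_on_besov (s p : R) (F : dist W -> L2 leb mOmega) : Prop :=
  forall (a : R) (u v : dist W), besov s p u -> besov s p v ->
    L2eq (F (a *: u + v)) (a *: F u + F v).

Definition continuous_on_besov (s p : R) (F : dist W -> L2 leb mOmega) : Prop :=
  forall u, besov s p u -> forall e : R, 0 < e ->
    exists2 r : R, 0 < r &
      forall u', besov s p u' -> (besov_norm s p (u' - u) < r%:E)%E ->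
        (L2norm (F u' - F u) < e%:E)%E.

Definition conj_exp (p : R) : R := (1 - p^-1)^-1.

(* F^* w, as an element of (B^s_p)^* = B^{-s}_{p*}, is g *)
Definition adjoint_at (s p : R) (F : dist W -> L2 leb mOmega)
    (w : L2 leb mOmega) (g : dist W) : Prop :=
  besov (- s) (conj_exp p) g /\
  forall u, besov s p u -> L2inner (F u) w = duality g u.

Definition adjoint_range (s p : R) (F : dist W -> L2 leb mOmega) :
    set (dist W) :=
  [set g | exists w, adjoint_at s p F w g].

Definition tikhonov (F : dist W -> L2 leb mOmega) (y : L2 leb mOmega)
    (a s p : R) (u : dist W) : \bar R :=
  (L2norm (F u - y) `^ 2 + a%:E * besov_norm s p u `^ p)%E.

Definition is_minimizer_on (D : set (dist W)) (T : dist W -> \bar R)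
    (u : dist W) : Prop :=
  D u /\ forall u', D u' -> (T u <= T u')%E.

End besov.

Arguments besov {R d leb Omega mOmega} W s p.
Arguments besov_norm {R d leb Omega mOmega W} s%_R p%_R u%_R.
Arguments sobolev_norm {R d leb Omega mOmega W} s%_R u%_R.

(* Main.v *)
(* In the coordinates x_l = 2^(sigma |l|) u_l the penalty is sum_l |x_l|^p with
   p = pR in (1, 2], and the H^sigma norm is the l_2 norm of x.  The bound on sR
   puts the gradient xi of the penalty at udag in B^sG_pG = rg F^*, so xi = F^* w.
   Comparing the Tikhonov functional at the minimizer and at udag then bounds the
   Bregman distance of the penalty by a multiple of delta.  The minimizers have
   bounded penalty, and on bounded sets of l_p with p <= 2 the Bregman distance
   dominates the squared l_2 distance. *)
Require Import Defs.
From mathcomp Require Import all_boot all_order all_algebra.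
From mathcomp Require Import all_classical all_reals all_analysis.
From mathcomp Require Import measurable_realfun ring lra.

Set Implicit Arguments.
Unset Strict Implicit.
Unset Printing Implicit Defensive.

Import Order.TTheory GRing.Theory Num.Theory.
Import numFieldNormedType.Exports.

Local Open Scope classical_set_scope.
Local Open Scope ring_scope.

(** * Scalar inequalities: uniform convexity of the power function on bounded intervals *)

Section powR_bregman.
Context {R : realType}.
Implicit Types a b c q p M : R.

(** Concavity of the power function, obtained from Young's inequality:
    [a^q * c^(1-q) <= q a + (1-q) c], divided by [c^(1-q)]. The case [q = 1] is separate because the
    conjugate exponent [1/(1-q)] degenerates. *)
Lemma powR_le_tangent a c q : 0 <= a -> 0 < c -> 0 < q <= 1 ->
  a `^ q <= c `^ q + q * c `^ (q - 1) * (a - c).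
Proof.
move=> a0 c0 /andP[q0]; rewrite le_eqVlt => /predU1P[->|q1].
  by rewrite subrr powRr0 !powRr1 ?(ltW c0)//; lra.
have cq : c `^ (q - 1) * c = c `^ q by rewrite mulrC mulr_powRB1// ltW.
have c10 : 0 < c `^ (1 - q) by rewrite powR_gt0.
have cc : c `^ (q - 1) * c `^ (1 - q) = 1.
  rewrite -powRD; last by rewrite (gt_eqF c0) implybT.
  by rewrite addrC subrKA subrr powRr0.
have := @conjugate_powR R (a `^ q) (c `^ (1 - q)) q^-1 (1 - q)^-1 (powR_ge0 _ _)
  (powR_ge0 _ _).
rewrite !invr_gt0 !invrK q0 subr_gt0 q1 => /(_ isT isT).
rewrite subrKC => /(_ erefl).
rewrite -!powRrM !mulfV ?gt_eqF// ?subr_gt0// !powRr1// ?(ltW c0)// => young.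
rewrite -(@ler_pM2r _ (c `^ (1 - q)))//; apply: (le_trans young).
rewrite -cq [leRHS](_ : _ = c `^ (q - 1) * c `^ (1 - q) * (c + q * (a - c))).
  by rewrite cc; lra.
by ring.
Qed.

Lemma ler_powR_neg a M q : 0 < a <= M -> q <= 0 -> M `^ q <= a `^ q.
Proof.
move=> /andP[a0 aM] q0; rewrite -(opprK q) !(powRN _ (- q)).
have M0 := lt_le_trans a0 aM.
rewrite lef_pV2 ?posrE ?powR_gt0// ge0_ler_powR ?oppr_ge0//.
- by rewrite nnegrE ltW.
- by rewrite nnegrE ltW.
Qed.

(** The tangent at [c] has slope [q c^(q-1)], which is at least [q M^(q-1)] because the exponent is
    nonpositive. With [q = p - 1] this is strong monotonicity of the derivative of [x^p] on
    [[0, M]]. *)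
Lemma powR_sub_ge a c q M : 0 <= a -> a <= c -> c <= M -> 0 < q <= 1 ->
  q * M `^ (q - 1) * (c - a) <= c `^ q - a `^ q.
Proof.
move=> a0 ac cM q01.
have [ae|ae] := eqVneq a c; first by rewrite ae !subrr mulr0.
have c0 : 0 < c by rewrite (le_lt_trans a0)// lt_neqAle ae.
have /andP[q0 q1] := q01.
have tangent := powR_le_tangent a0 c0 q01.
have Mc : M `^ (q - 1) <= c `^ (q - 1) by rewrite ler_powR_neg ?c0// subr_le0.
have : q * M `^ (q - 1) * (c - a) <= q * c `^ (q - 1) * (c - a).
  by rewrite ler_wpM2r ?subr_ge0// ler_wpM2l// ltW.
by lra.
Qed.

Lemma powR_ge_sqr a M p : 0 <= a <= M -> 0 < p <= 2 ->
  M `^ (p - 2) * a ^+ 2 <= a `^ p.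
Proof.
move=> /andP[a0 aM] /andP[p0 p2].
have [->|ane] := eqVneq a 0; first by rewrite expr0n mulr0 powR_ge0.
have a_gt0 : 0 < a by rewrite lt_neqAle eq_sym ane.
rewrite -[in leRHS](subrK 2 p) [leRHS]powRD ?ane ?implybT// powR_mulrn//.
by rewrite ler_wpM2r ?sqr_ge0// ler_powR_neg ?a_gt0// subr_le0.
Qed.

Lemma continuous_powR_itv a b p : 0 <= a -> a < b -> 0 < p ->
  {within `[a, b], continuous (fun x : R => x `^ p)}.
Proof.
move=> a0 ab p0.
have cont x : 0 < x -> {for x, continuous (fun x : R => x `^ p)}.
  move=> x0; apply/differentiable_continuous/derivable1_diffP.
  by apply: derivable_powR; rewrite in_itv/= andbT.
apply/continuous_within_itvP => //; split.
- by move=> x /[!in_itv]/= /andP[ax _]; apply: cont; exact: le_lt_trans ax.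
(* Differentiability is only available at positive points, so the endpoint 0 needs its own one-sided
   limit. *)
- have [->|ane] := eqVneq a 0.
    by rewrite powR0 ?gt_eqF//; exact: powR_cvg0.
  by apply: cvg_at_right_filter; apply: cont; rewrite lt_neqAle eq_sym ane.
- by apply: cvg_at_left_filter; apply: cont; exact: le_lt_trans ab.
Qed.

(** Subtracting [m/2 x^2] from [x^p] leaves a convex function on [[0, M]]: its derivative [dh] is
    nondecreasing there. The mean value theorem then puts it above its tangents. *)
Lemma bregman_powR_ge0 a b p M : 0 <= a <= M -> 0 <= b <= M -> 1 < p <= 2 ->
  a `^ p + p * a `^ (p - 1) * (b - a) +
    2^-1 * (p - 1) * M `^ (p - 2) * (b - a) ^+ 2 <= b `^ p.
Proof.
move=> /andP[a0 aM] /andP[b0 bM] /andP[p1 p2].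
(* [m] is the least value of the second derivative of [x^p] on [(0, M]], attained at [M] since
   [p <= 2]. *)
pose m := p * (p - 1) * M `^ (p - 2).
pose h (x : R) := x `^ p - 2^-1 * m * x ^+ 2.
pose dh (x : R) := p * x `^ (p - 1) - m * x.
have m_ge0 : 0 <= m by rewrite !mulr_ge0 ?powR_ge0 ?subr_ge0//; lra.
have dh_mono x y : 0 <= x -> x <= y -> y <= M -> dh x <= dh y.
  move=> x0 xy yM.
  have pp : 0 < p - 1 <= 1 by apply/andP; split; lra.
  have := powR_sub_ge x0 xy yM pp.
  rewrite (_ : p - 1 - 1 = p - 2); last by lra.
  rewrite -(ler_pM2l (lt_trans ltr01 p1)) /dh /m.
  lra.
have hder (x : R) : 0 < x -> is_derive x 1 h (dh x).
  move=> x0.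
  have := is_derive1_powR p x0 => ?.
  rewrite /h; apply: is_derive_eq.
  by rewrite /dh /GRing.scale/= ; lra.
have hcont (x y : R) : 0 <= x -> x < y -> {within `[x, y], continuous h}.
  move=> x0 xy z; apply: cvgB.
    by apply: continuous_powR_itv => //; lra.
  apply: cvgM; first exact: cvg_cst.
  have sq : {within `[x, y], continuous (fun t : R => t ^+ 2)}.
    by apply: continuous_subspaceT => t; exact: exprn_continuous.
  exact: sq.
have mvt (x y : R) : 0 <= x -> x < y ->
    exists2 c, x < c < y & h y - h x = dh c * (y - x).
  move=> x0 xy.
  have hd z : z \in `]x, y[ -> is_derive z 1 h (dh z).
    by rewrite in_itv/= => /andP[xz _]; apply: hder; exact: le_lt_trans xz.
  by have [c] := MVT xy hd (hcont _ _ x0 xy); rewrite in_itv/=; exists c.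
have key : dh a * (b - a) <= h b - h a.
  have [ab|ba|->] := ltgtP a b; last by rewrite !subrr mulr0.
  - have [c /andP[ac cb] ->] := mvt _ _ a0 ab.
    by rewrite ler_wpM2r ?subr_ge0 ?(ltW ab)// dh_mono ?(ltW ac)
      ?(le_trans (ltW cb)).
  - have [c /andP[bc ca] hc] := mvt _ _ b0 ba.
    rewrite -[h b - h a]opprB hc -mulrN opprB ler_wnM2r ?subr_le0 ?(ltW ba)//.
    exact: dh_mono (le_trans b0 (ltW bc)) (ltW ca) aM.
have q0 : 0 <= p - 1 by lra.
(* The argument yields the gain with constant [p (p-1) / 2], the statement claims [(p-1) / 2]; this
   term is twice the surplus. *)
have : 0 <= (p - 1) * ((p - 1) * M `^ (p - 2) * (b - a) ^+ 2).
  exact: mulr_ge0 q0 (mulr_ge0 (mulr_ge0 q0 (powR_ge0 _ _)) (sqr_ge0 _)).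
have aa : a * a `^ (p - 1) = a `^ p by rewrite mulr_powRB1//; lra.
move: key; rewrite /h /dh /m -aa.
lra.
Qed.

(* The gain (p - 1) / 2 M^(p - 2) (b - a)^2 over plain convexity is what makes the
   Bregman distance of the penalty control the squared error. *)
Lemma bregman_powR a b p M : `|a| <= M -> `|b| <= M -> 1 < p <= 2 ->
  `|a| `^ p + p * `|a| `^ (p - 1) * Num.sg a * (b - a) +
    2^-1 * (p - 1) * M `^ (p - 2) * (b - a) ^+ 2 <= `|b| `^ p.
Proof.
move=> + + p12; have /andP[p1 p2] := p12.
(* The inequality is invariant under changing the signs of [a] and [b] together. *)
wlog a0 : a b / 0 <= a => [hw|].
  have [/hw//|a0 aM bM] := leP 0 a; first exact.
  have := hw (- a) (- b); rewrite oppr_ge0 !normrN sgrN => /(_ (ltW a0) aM bM).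
  by apply: le_trans; rewrite le_eqVlt; apply/orP; left; apply/eqP; ring.
rewrite (ger0_norm a0) => aM bM.
have sgE : a `^ (p - 1) * Num.sg a = a `^ (p - 1).
  have [->|ane] := eqVneq a 0; last by rewrite gtr0_sg ?mulr1// lt_neqAle eq_sym ane.
  by rewrite powR0 ?mul0r// gt_eqF// subr_gt0.
rewrite -(mulrA p) sgE.
have [b0|b0] := leP 0 b.
  by rewrite (ger0_norm b0) in bM *; apply: bregman_powR_ge0; rewrite ?a0 ?b0.
rewrite (ltr0_norm b0) in bM *.
(* For opposite signs, [(a + c)^2 = 2 a^2 + 2 c^2 - (a - c)^2], and [powR_ge_sqr] bounds the squares
   by [a^p] and [c^p]. The resulting [(p-1) a^p] cancels, and [(p-1) c^p <= c^p] because
   [p <= 2]. *)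
set c := - b in bM *; have -> : b = - c by rewrite /c opprK.
have c0 : 0 < c by rewrite /c oppr_gt0.
have aa : a * a `^ (p - 1) = a `^ p by rewrite mulr_powRB1//; lra.
have p02 : 0 < p <= 2 by rewrite p2 (lt_trans ltr01).
have sa := @powR_ge_sqr a M p; rewrite a0 aM in sa; have {}sa := sa isT p02.
have sc := @powR_ge_sqr c M p; rewrite (ltW c0) bM in sc; have {}sc := sc isT p02.
have cp0 : 0 <= c `^ p by exact: powR_ge0.
have ac : 0 <= p * (a `^ (p - 1) * c) by rewrite !mulr_ge0 ?powR_ge0//; lra.
have q0 : 0 <= p - 1 by lra.
have h1 := ler_wpM2l q0 (lerD sa sc).
have h2 : 0 <= (2 - p) * c `^ p by rewrite mulr_ge0// subr_ge0.
have h3 : 0 <= 2^-1 * (p - 1) * M `^ (p - 2) * (a - c) ^+ 2.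
  by rewrite mulr_ge0 ?sqr_ge0 ?mulr_ge0 ?powR_ge0// invr_ge0.
move: h1 h2 h3 ac; rewrite -aa; lra.
Qed.

End powR_bregman.

(** * Sums of nonnegative families *)

Lemma esumZl (R : realType) (T : choiceType) (A : set T) (k : R)
    (a : T -> \bar R) : 0 < k -> (forall i, 0 <= a i)%E ->
  (\esum_(i in A) (k%:E * a i) = k%:E * \esum_(i in A) a i)%E.
Proof.
(* One inequality suffices: the reverse one follows by applying it to [k^-1] and the family
   [k a]. *)
have half (k' : R) b : 0 < k' -> (forall i, 0 <= b i)%E ->
    (\esum_(i in A) (k'%:E * b i) <= k'%:E * \esum_(i in A) b i)%E.
  move=> k0 b0; apply: ge_ereal_sup => _ [X [finX XA] <-].
  rewrite -ge0_mule_fsumr// lee_pmul2l ?lte_fin//.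
  by apply: ereal_sup_ubound; exists X.
move=> k0 a0; apply/eqP; rewrite eq_le half//=.
rewrite -lee_pdivlMl//.
apply: le_trans (half k^-1 (fun i => k%:E * a i)%E _ _).
- apply: le_esum => i _.
  by rewrite muleA -EFinM mulVf ?gt_eqF// mul1e.
- by rewrite invr_gt0.
- by move=> i; rewrite mule_ge0// lee_fin ltW.
Qed.

Lemma esum_lty_le (R : realType) (T : choiceType) (A : set T)
    (a b : T -> \bar R) : (forall i, a i <= b i)%E ->
  (\esum_(i in A) b i < +oo)%E -> (\esum_(i in A) a i < +oo)%E.
Proof. by move=> ab; apply: le_lt_trans; apply: le_esum. Qed.

Lemma ler_esum_term (R : realType) (T : choiceType) (a : T -> R) (N : R) i :
  (\esum_(j in [set: T]) (a j)%:E <= N%:E)%E -> a i <= N.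
Proof.
move=> aN; rewrite -lee_fin; apply: le_trans aN; apply: esum_ge.
by exists [set i]; [split|rewrite fsbig_set1].
Qed.

(** Comparing with the larger of the two moduli avoids convexity, so the quasi-norm range [p < 1] is
    included. *)
Lemma powR_normD_le (R : realType) (a b p : R) : 0 <= p ->
  `|a + b| `^ p <= 2 `^ p * (`|a| `^ p + `|b| `^ p).
Proof.
move=> p0; pose c : R := Num.max `|a| `|b|.
have c0 : 0 <= c by rewrite le_max normr_ge0.
have abc : `|a + b| <= 2 * c.
  rewrite (le_trans (ler_normD _ _))// mulr_natl mulr2n lerD// /c le_max lexx//.
  by rewrite orbT.
have := ge0_ler_powR p0 _ _ abc; rewrite !nnegrE mulr_ge0// => /(_ (normr_ge0 _) isT).
move/le_trans; apply; rewrite powRM// ler_wpM2l ?powR_ge0//.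
by rewrite /c; case: (leP `|a| `|b|) => _; rewrite (lerDl, lerDr) powR_ge0.
Qed.

(** * Besov spaces as weighted sequence spaces, and their duality *)

Section besov_sums.
Context {R : realType} {d : nat} {leb : {measure set (Rn R d) -> \bar R}}
  {Omega : set (Rn R d)} {mOmega : measurable Omega}
  (W : wavelet_basis leb mOmega).
Implicit Types (s p : R) (u g : dist W).

(** The [p]-th root of the weight in the Besov norm, so that this norm becomes the plain [l_p] norm
    of the rescaled coefficients. *)
Definition besov_weight s p (l : windex W) : R :=
  2 `^ ((s + d%:R * (2^-1 - p^-1)) * (scale l)%:R).

Lemma besov_weight_gt0 s p l : 0 < besov_weight s p l.
Proof. exact: powR_gt0. Qed.

Definition besov_sum s p (c : windex W -> R) : \bar R :=
  \esum_(l in [set: windex W]) (`|besov_weight s p l * c l| `^ p)%:E.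

Lemma besov_sum_ge0 s p c : (0 <= besov_sum s p c)%E.
Proof. by apply: esum_ge0 => l _; rewrite lee_fin powR_ge0. Qed.

Lemma besov_seq_normE s p c : besov_seq_norm s p c = (besov_sum s p c `^ p^-1)%E.
Proof.
rewrite /besov_seq_norm /besov_sum; congr (_ `^ _)%E; apply: eq_esum => l _.
rewrite normrM powRM// gtr0_norm ?besov_weight_gt0// /besov_weight -powRrM.
by congr (_ `^ _ * _)%:E; ring.
Qed.

Lemma besov_seq_norm_lty s p c : p != 0 ->
  (besov_seq_norm s p c < +oo)%E = (besov_sum s p c < +oo)%E.
Proof.
move=> p0; rewrite besov_seq_normE; apply/idP/idP; last exact: poweR_lty.
by apply: lty_poweRy; rewrite invr_eq0.
Qed.

Lemma besovP s p u : p != 0 ->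
  besov W s p u <-> (besov_sum s p (coef u) < +oo)%E.
Proof. by move=> p0; rewrite /besov/= /besov_norm besov_seq_norm_lty. Qed.

Lemma besov_norm_powR s p u : p != 0 ->
  (besov_norm s p u `^ p)%E = besov_sum s p (coef u).
Proof.
move=> p0; rewrite /besov_norm besov_seq_normE -poweRrM mulVf// poweRe1//.
exact: besov_sum_ge0.
Qed.

Lemma coefB u u' l : coef (u - u') l = coef u l - coef u' l.
Proof. by rewrite addrC -scaleN1r coef_linear; ring. Qed.

Lemma besovB s p u u' : 0 < p -> besov W s p u -> besov W s p u' ->
  besov W s p (u - u').
Proof.
move=> p0; have pN0 : p != 0 by rewrite gt_eqF.
move=> /(besovP _ _ pN0) fu /(besovP _ _ pN0) fu'; apply/(besovP _ _ pN0).
apply: (@esum_lty_le _ _ _ _ (fun l => (2 `^ p)%:E *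
   ((`|besov_weight s p l * coef u l| `^ p)%:E +
    (`|besov_weight s p l * coef u' l| `^ p)%:E))%E).
  move=> l; rewrite coefB mulrBr -EFinD -EFinM lee_fin.
  by rewrite -(normrN (_ * coef u' l)) powR_normD_le// ltW.
rewrite esumZl ?powR_gt0//; last first.
  by move=> l; rewrite adde_ge0// lee_fin powR_ge0.
rewrite esumD; [|by move=> *; rewrite lee_fin powR_ge0..].
apply: lte_mul_pinfty; rewrite ?lee_fin ?powR_ge0//.
exact: lte_add_pinfty fu fu'.
Qed.

Lemma conj_exp_gt1 p : 1 < p -> 1 < conj_exp p.
Proof.
move=> p1; rewrite /conj_exp invf_gt1 ?subr_gt0 ?invf_lt1 ?(lt_trans ltr01)//.
by rewrite gtrBl invr_gt0 (lt_trans ltr01).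
Qed.

(** The weights of the space and of its dual are reciprocal, so the product of coefficients equals
    that of the rescaled ones, and Young's inequality dominates it termwise. *)
Lemma summable_duality s p g u : 1 < p -> besov W (- s) (conj_exp p) g ->
  besov W s p u -> summable [set: windex W] (fun l => (coef g l * coef u l)%:E).
Proof.
move=> p1; have q1 := conj_exp_gt1 p1.
have p0 := lt_trans ltr01 p1; have q0 := lt_trans ltr01 q1.
move=> /(besovP _ _ (lt0r_neq0 q0)) fg /(besovP _ _ (lt0r_neq0 p0)) fu.
apply: (@esum_lty_le _ _ _ _ (fun l =>
   ((`|besov_weight (- s) (conj_exp p) l * coef g l| `^ conj_exp p)%:E +
    (`|besov_weight s p l * coef u l| `^ p)%:E))%E); last first.
  rewrite esumD; [|by move=> *; rewrite lee_fin powR_ge0..].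
  exact: lte_add_pinfty.
move=> l; rewrite -EFinD lee_fin.
set a := besov_weight _ _ _ * _; set b := besov_weight _ _ _ * _.
have -> : coef g l * coef u l = a * b.
  rewrite /a /b mulrACA -[LHS]mul1r; congr (_ * _).
  rewrite /besov_weight -powRD ?pnatr_eq0 ?implybT//.
  rewrite -mulrDl (_ : _ + _ = 0) ?mul0r ?powRr0// /conj_exp invrK.
  by field; rewrite gt_eqF.
rewrite normrM.
have := @conjugate_powR _ `|a| `|b| (conj_exp p) p (normr_ge0 _) (normr_ge0 _) q0 p0.
rewrite {1}/conj_exp invrK subrK => /(_ erefl) /le_trans; apply.
apply: lerD; rewrite ler_piMr ?powR_ge0//.
  by rewrite gerBl invr_ge0 ltW.
by rewrite invf_le1// ltW.
Qed.

(** Finiteness of both parts makes the [fine] in [duality] faithful. The equation is written without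
    subtraction, ready for use in extended inequalities. *)
Lemma fin_duality s p g u : 1 < p -> besov W (- s) (conj_exp p) g ->
  besov W s p u -> let t := fun l => (coef g l * coef u l)%:E in
  [/\ (esum [set: windex W] t^\+ \is a fin_num)%E,
      (esum [set: windex W] t^\- \is a fin_num)%E &
      (esum [set: windex W] t^\+ =
        (duality g u)%:E + esum [set: windex W] t^\-)%E].
Proof.
move=> p1 fg fu t.
have st : summable [set: windex W] t by exact: summable_duality p1 fg fu.
have fp : (esum [set: windex W] t^\+ \is a fin_num)%E.
  have := summable_funepos st; rewrite summableE.
  congr (_ \is a fin_num); apply: eq_esum => l _.
  by rewrite gee0_abs// funepos_ge0.
have fn : (esum [set: windex W] t^\- \is a fin_num)%E.
  have := summable_funeneg st; rewrite summableE.
  congr (_ \is a fin_num); apply: eq_esum => l _.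
  by rewrite gee0_abs// funeneg_ge0.
split=> //.
by rewrite /duality fineK ?fin_numB ?fp ?fn// subeK.
Qed.

End besov_sums.

(** * The norm and inner product of square-integrable functions *)

Section L2_facts.
Context {R : realType} {d : nat} {leb : {measure set (Rn R d) -> \bar R}}
  {Omega : set (Rn R d)} {mOmega : measurable Omega}.
Implicit Types f g h : L2 leb mOmega.

Lemma fin_L2norm f : L2norm f \is a fin_num.
Proof. by rewrite ge0_fin_numE ?Lnorm_ge0//; exact: Lfunction_finite. Qed.

Lemma L2_subE f g x : (f - g) x = f x - g x.
Proof. by []. Qed.

Lemma L2_combE a f g x : (a *: f + g) x = a * f x + g x.
Proof. by []. Qed.

Lemma L2norm_congr f g : L2eq f g -> L2norm f = L2norm g.
Proof.
move=> fg; rewrite /L2norm unlock /Lnorm.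
have mpow (h : L2 leb mOmega) :
    measurable_fun [set: Rn R d] (fun x => `|h x| `^ 2 : R).
  apply: (@measurableT_comp _ _ _ _ _ _ (fun x : R => x `^ 2)) => //.
  exact: measurableT_comp.
rewrite (ae_eq_integral (fun x => `|(EFin \o g) x| `^ 2)%E) => //.
- by have /measurable_EFinP := mpow f.
- by have /measurable_EFinP := mpow g.
- by move: fg; rewrite /L2eq; apply: filterS => x /= ->.
Qed.

Lemma ler_L2norm_subl f g h :
  (L2norm (f - h) <= L2norm (f - g) + L2norm (h - g))%E.
Proof.
have -> : L2norm (h - g) = L2norm (g - h).
  rewrite /L2norm -oppe_Lnorm; apply: eq_Lnorm => x.
  by rewrite /= opprB.
have -> : f - h = (f - g) + (g - h) by rewrite addrA subrK.
by apply: eminkowski => //; exact: le1_2e.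
Qed.

Lemma L2inner_cauchy_schwarz f g :
  `|L2inner f g| <= fine (L2norm f) * fine (L2norm g).
Proof.
have Lf := LfunP f; have Lg := LfunP g.
have /Lfun1_integrable fgi := Lfun2_mul_Lfun1 Lf Lg.
apply: (le_trans (le_normr_Rintegral _ fgi)) => //.
rewrite -lee_fin EFinM !fineK ?fin_L2norm//.
  have := @hoelder _ _ _ (mrestr leb mOmega) f g 2 2.
  by rewrite Lnorm1; apply => //; rewrite [RHS]splitr !div1r.
have /integrableP[_] := fgi.
by rewrite ge0_fin_numE// integral_ge0.
Qed.
End L2_facts.

(** * Bregman inequality for sequences, and the scalar error estimate *)

Lemma bregman_esum (R : realType) (T : choiceType) (p M : R) (x y : T -> R)
    (t : T -> \bar R) :
  1 < p <= 2 -> 0 < M -> (forall l, `|x l| <= M) -> (forall l, `|y l| <= M) ->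
  (forall l, t l = (p * `|x l| `^ (p - 1) * Num.sg (x l) * (y l - x l))%:E) ->
  ((2^-1 * (p - 1) * M `^ (p - 2))%:E *
      (\esum_(l in [set: T]) (`|y l - x l| `^ 2)%:E)
    + (\esum_(l in [set: T]) (`|x l| `^ p)%:E) + esum [set: T] t^\+
   <= (\esum_(l in [set: T]) (`|y l| `^ p)%:E) + esum [set: T] t^\-)%E.
Proof.
move=> p12 M0 xM yM tE; have /andP[p1 _] := p12.
have K0 : 0 < 2^-1 * (p - 1) * M `^ (p - 2).
  by rewrite !mulr_gt0 ?powR_gt0 ?invr_gt0// subr_gt0.
rewrite -esumZl//.
have pow0 (z : T -> R) q l : [set: T] l -> (0 <= (`|z l| `^ q)%:E)%E.
  by rewrite lee_fin powR_ge0.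
have gain0 l : [set: T] l ->
    (0 <= (2^-1 * (p - 1) * M `^ (p - 2))%:E * (`|y l - x l| `^ 2)%:E)%E.
  by move=> _; rewrite mule_ge0// lee_fin ?powR_ge0 ?ltW.
(* The linear term has no fixed sign; with its positive and negative parts on opposite sides, all
   five sums are nonnegative and can be merged and compared termwise without any finiteness. *)
rewrite -!esumD//; [|by move=> l Tl; rewrite adde_ge0 ?pow0 ?gain0|exact: pow0..].
apply: le_esum => l _; have := bregman_powR (xM l) (yM l) p12.
rewrite funeposE funenegE tE -EFinN -EFin_max -EFin_max -EFinM -!EFinD lee_fin.
rewrite powR_mulrn// real_normK ?num_real//.
set z := p * _ * _ * _.
have : z = Num.max z 0 - Num.max (- z) 0.
  have [z0|z0] := leP 0 z.
    by rewrite max_r ?oppr_le0// subr0.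
  by rewrite max_l ?oppr_ge0 ?ltW// sub0r opprK.
lra.
Qed.

(** Here [t] is the residual, [A] and [B] the penalties at the solution and the minimizer, [tau] the
    pairing with the source element and [om] the norm of [w]. Combining the hypotheses gives
    [a D <= delta^2 - t^2 + a (t + delta) om]. Completing the square removes [t] at the cost
    [a^2 om^2 / 4]; division by [a], which is comparable to [delta], finishes. *)
Lemma tikhonov_estimate (R : realType) (a delta t A B D tau om c C : R) :
  0 < delta <= 1 -> 0 < c -> c * delta <= a <= C * delta ->
  t ^+ 2 + a * B <= delta ^+ 2 + a * A ->
  D + A + tau <= B -> `|tau| <= (t + delta) * om ->
  D <= (c^-1 + om + C * om ^+ 2 / 4) * delta.
Proof.
move=> /andP[d0 d1] c0 /andP[ca aC] tik breg tauom.
have a0 : 0 < a by rewrite (lt_le_trans _ ca)// mulr_gt0.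
have tau_ge : - tau <= (t + delta) * om.
  by rewrite (le_trans _ tauom)// -normrN ler_norm.
have h1 : a * D <= delta ^+ 2 + a * (om * delta) + a ^+ 2 * om ^+ 2 / 4.
  have := ler_wpM2l (ltW a0) breg; have := ler_wpM2l (ltW a0) tau_ge.
  have := sqr_ge0 (t - a * om / 2).
  lra.
have h2 : delta ^+ 2 <= a * (c^-1 * delta).
  have : 0 <= delta * c^-1 * (a - c * delta).
    by rewrite mulr_ge0 ?subr_ge0// divr_ge0 ?ltW.
  rewrite (_ : _ * (a - _) = a * (c^-1 * delta) - delta ^+ 2) ?subr_ge0//.
  by field; rewrite gt_eqF.
have h3 : a ^+ 2 * om ^+ 2 / 4 <= a * (C * om ^+ 2 / 4 * delta).
  have : 0 <= a * (om ^+ 2 / 4) * (C * delta - a).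
    by rewrite mulr_ge0 ?subr_ge0// mulr_ge0 ?(ltW a0)// divr_ge0 ?sqr_ge0.
  lra.
rewrite -(ler_pM2l a0); lra.
Qed.

Lemma ler_powR_root (R : realType) (x N p : R) : 0 < p -> 0 <= x ->
  x `^ p <= N -> x <= N `^ p^-1.
Proof.
move=> p0 x0 xN; have N0 : 0 <= N := le_trans (powR_ge0 _ _) xN.
have p10 : 0 <= p^-1 by rewrite invr_ge0 ltW.
have := ge0_ler_powR p10 (powR_ge0 x p) N0 xN.
by rewrite -powRrM mulfV ?gt_eqF// powRr1.
Qed.

(** * The gradient of the penalty at the solution lies in the range of the adjoint *)

Section source_condition.
Context {R : realType} {d : nat} {leb : {measure set (Rn R d) -> \bar R}}
  {Omega : set (Rn R d)} {mOmega : measurable Omega}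
  (W : wavelet_basis leb mOmega).

Lemma besov_weight_scale (s p e : R) (l : windex W) :
  besov_weight s p l `^ e = 2 `^ (e * (s + d%:R * (2^-1 - p^-1)) * (scale l)%:R).
Proof. by rewrite /besov_weight -powRrM; congr (_ `^ _); ring. Qed.

(** Since [pR pG = pS + pG], the multiples of [d] in the exponents cancel, and what remains is
    exactly the bound on [sR]. *)
Lemma besov_weight_source (sG pG sS pS sR pR : R) (l : windex W) :
  0 < pG -> 0 < pS -> pR = (pS + pG) / pG ->
  sR <= (pS * sS - pG * sG) / (pS + pG) ->
  besov_weight sG pG l `^ pG * besov_weight sR pR l `^ (pR * pG)
    <= besov_weight sS pS l `^ pS.
Proof.
move=> pG0 pS0 pRE sRle; have SG0 : 0 < pS + pG by rewrite addr_gt0.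
have pRpG : pR * pG = pS + pG by rewrite pRE divfK// gt_eqF.
rewrite !besov_weight_scale -powRD ?pnatr_eq0 ?implybT// ler_powR ?ler1n//.
rewrite -mulrDl ler_wpM2r//.
rewrite ler_pdivlMr// in sRle.
have -> : pG * (sG + d%:R * (2^-1 - pG^-1)) = pG * sG + d%:R * (pG / 2 - 1).
  by field; rewrite gt_eqF.
have -> : pS * (sS + d%:R * (2^-1 - pS^-1)) = pS * sS + d%:R * (pS / 2 - 1).
  by field; rewrite gt_eqF.
have -> : pR * pG * (sR + d%:R * (2^-1 - pR^-1)) =
    sR * (pS + pG) + d%:R * (pS / 2 - pG / 2).
  rewrite pRpG pRE invf_div.
  by field; rewrite gt_eqF.
lra.
Qed.

(* [xi] is the gradient of the penalty [sum_l |x_l|^pR] at [u], in coordinates [u_l]. *)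
Lemma besov_penalty_gradient (sG pG sS pS sR pR : R) (u : dist W) :
  0 < pG -> 0 < pS -> pR = (pS + pG) / pG ->
  sR <= (pS * sS - pG * sG) / (pS + pG) ->
  characterizes W sG pG -> besov W sS pS u ->
  exists2 xi, besov W sG pG xi & forall l,
    let x := besov_weight sR pR l * coef u l in
    coef xi l = besov_weight sR pR l * (pR * `|x| `^ (pR - 1) * Num.sg x).
Proof.
move=> pG0 pS0 pRE sRle charG /(besovP _ _ (lt0r_neq0 pS0)) uS.
pose x l := besov_weight sR pR l * coef u l.
pose c l := besov_weight sR pR l * (pR * `|x l| `^ (pR - 1) * Num.sg (x l)).
have pR0 : 0 < pR by rewrite pRE divr_gt0// addr_gt0.
(* This is what the choice of [pR] achieves: the [pG]-th power of [|z|^(pR-1)] is [|z|^pS], summable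
   with the weights of [u]. *)
have pR1 : pR - 1 = pS / pG by rewrite pRE mulrDl mulfV ?gt_eqF// addrK.
suff cG : (besov_sum sG pG c < +oo)%E.
  have [|xi xiE] := charG c; first by rewrite besov_seq_norm_lty// gt_eqF.
  exists xi; last by move=> l; rewrite xiE.
  by apply/(besovP _ _ (lt0r_neq0 pG0)); rewrite xiE.
apply: (@esum_lty_le _ _ _ _ (fun l => (pR `^ pG)%:E *
    (`|besov_weight sS pS l * coef u l| `^ pS)%:E)%E); last first.
  by rewrite esumZl ?powR_gt0//; apply: lte_mul_pinfty; rewrite ?lee_fin ?powR_ge0.
move=> l; rewrite -EFinM lee_fin /c /x.
have wG := besov_weight_gt0 sG pG l; have wR := besov_weight_gt0 sR pR l.
have wS := besov_weight_gt0 sS pS l.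
set g := besov_weight sG pG l in wG *; set w := besov_weight sR pR l in wR *.
set h := besov_weight sS pS l in wS *; set z := coef u l.
rewrite !normrM (gtr0_norm wG) (gtr0_norm wR) (gtr0_norm wS) (gtr0_norm pR0).
rewrite (ger0_norm (powR_ge0 _ _)) (powRM _ (ltW wR))//.
(* Only an inequality, since the sign of 0 is 0. *)
have sg1 : `|Num.sg (w * z)| <= 1 by rewrite normr_sg lern1 leq_b1.
have := besov_weight_source l pG0 pS0 pRE sRle; rewrite -/g -/w -/h => ghw.
have E : (g * (w * (pR * (w `^ (pR - 1) * `|z| `^ (pR - 1))))) `^ pG =
    pR `^ pG * (g `^ pG * w `^ (pR * pG) * `|z| `^ pS).
  rewrite (_ : g * _ = pR * (g * w `^ pR * `|z| `^ (pR - 1))); last first.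
    by rewrite -(mulr_powRB1 (ltW wR) pR0); ring.
  rewrite !powRM ?mulr_ge0 ?powR_ge0 ?(ltW wG) ?(ltW pR0)//.
  by rewrite -!powRrM pR1 divfK ?gt_eqF.
apply: (@le_trans _ _ ((g * (w * (pR * (w `^ (pR - 1) * `|z| `^ (pR - 1))))) `^ pG)).
  apply: ge0_ler_powR; rewrite ?nnegrE ?mulr_ge0 ?powR_ge0 ?(ltW wG)
    ?(ltW wR) ?(ltW pR0) ?(ltW pG0)//.
  do 2 (apply: ler_wpM2l; first exact: ltW).
  by rewrite ler_piMr ?mulr_ge0 ?powR_ge0 ?(ltW pR0).
rewrite E; apply: ler_wpM2l; first exact: powR_ge0.
by rewrite (powRM _ (ltW wS))// ler_wpM2r ?powR_ge0.
Qed.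

End source_condition.

(** * Finiteness of the penalty and comparison of Tikhonov values *)

Section tikhonov_minimizer.
Context {R : realType} {d : nat} {leb : {measure set (Rn R d) -> \bar R}}
  {Omega : set (Rn R d)} {mOmega : measurable Omega}
  (W : wavelet_basis leb mOmega).

(** By homogeneity the gradient paired with [u] is termwise [pR] times the penalty, so summability
    of the pairing makes the penalty finite. *)
Lemma besov_sum_gradient_fin (s p sR pR : R) (xi u : dist W) :
  1 < p -> 1 <= pR -> besov W (- s) (conj_exp p) xi -> besov W s p u ->
  (forall l, let x := besov_weight sR pR l * coef u l in
    coef xi l = besov_weight sR pR l * (pR * `|x| `^ (pR - 1) * Num.sg x)) ->
  besov_sum sR pR (coef u) \is a fin_num.
Proof.
move=> p1 pR1 fxi fu xiE; have pR0 : 0 < pR by rewrite (lt_le_trans ltr01).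
rewrite ge0_fin_numE ?besov_sum_ge0//.
apply: (esum_lty_le _ (summable_duality p1 fxi fu)) => l.
rewrite xiE /= lee_fin; set w := besov_weight _ _ _; set x := w * _.
have -> : w * (pR * `|x| `^ (pR - 1) * Num.sg x) * coef u l =
    pR * `|x| `^ pR.
  rewrite -(mulr_powRB1 (normr_ge0 x) pR0); set y := `|x| `^ (pR - 1).
  rewrite normrEsg; set e := Num.sg x; rewrite /x; ring.
rewrite [leRHS]ger0_norm ?mulr_ge0 ?powR_ge0 ?(ltW pR0)//.
by rewrite ler_peMl ?powR_ge0.
Qed.

(** For integrability index 2 the correction [d (1/2 - 1/p)] vanishes, so the weight of the Sobolev
    norm coincides with that of the penalty. *)
Lemma sobolev_normE (sigma sR pR : R) (u : dist W) :
  sigma = sR + d%:R * (2^-1 - pR^-1) ->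
  sobolev_norm sigma u =
    ((\esum_(l in [set: windex W])
       (`|besov_weight sR pR l * coef u l| `^ 2)%:E) `^ 2^-1)%E.
Proof.
move=> sE; rewrite /sobolev_norm /besov_norm besov_seq_normE.
suff -> : besov_sum sigma 2 (coef u) =
    \esum_(l in [set: windex W]) (`|besov_weight sR pR l * coef u l| `^ 2)%:E.
  by [].
apply: eq_esum => l _.
by rewrite /besov_weight subrr mulr0 addr0 sE.
Qed.

Lemma L2norm_minimizer_le (F : dist W -> L2 leb mOmega) (v y : L2 leb mOmega)
    (D : set (dist W)) (delta a s p : R) (u um : dist W) :
  p != 0 -> 0 < a -> D u -> L2eq (F u) v -> (L2norm (v - y) <= delta%:E)%E ->
  besov_sum s p (coef u) \is a fin_num ->
  is_minimizer_on D (tikhonov F y a s p) um ->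
  besov_sum s p (coef um) \is a fin_num /\
  fine (L2norm (F um - y)) ^+ 2 + a * fine (besov_sum s p (coef um)) <=
    delta ^+ 2 + a * fine (besov_sum s p (coef u)).
Proof.
move=> p0 a0 Du Fuv vy Afin [_ /(_ u Du)].
rewrite /tikhonov !besov_norm_powR// => tik.
have {}vy : (L2norm (F u - y) <= delta%:E)%E.
  rewrite (L2norm_congr (g := v - y))//.
  by move: Fuv; rewrite /L2eq; apply: filterS => x e; rewrite !L2_subE e.
have d0 : 0 <= delta.
  by rewrite -lee_fin; apply: le_trans vy; exact: Lnorm_ge0.
have sqrE (f : L2 leb mOmega) : (L2norm f `^ 2)%E = (fine (L2norm f) ^+ 2)%:E.
  rewrite -(fineK (fin_L2norm f)) poweR_EFin powR_mulrn//.
  by rewrite fine_ge0// Lnorm_ge0.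
rewrite !sqrE in tik.
have mulE (z : \bar R) : z \is a fin_num -> (a%:E * z = (a * fine z)%:E)%E.
  by move=> /fineK {1}<-.
have tik' : ((fine (L2norm (F um - y)) ^+ 2)%:E +
    a%:E * besov_sum s p (coef um) <=
    (delta ^+ 2 + a * fine (besov_sum s p (coef u)))%:E)%E.
  apply: (le_trans tik); rewrite (mulE _ Afin) -EFinD lee_fin lerD2r.
  by rewrite ler_sqr ?nnegrE ?fine_ge0 ?Lnorm_ge0// -lee_fin fineK ?fin_L2norm.
(* An infinite penalty, multiplied by [a > 0], would contradict the finite bound on the Tikhonov
   value. *)
have Bfin : besov_sum s p (coef um) \is a fin_num.
  have Bge0 := besov_sum_ge0 s p (coef um).
  rewrite ge0_fin_numE// ltey; apply/eqP => Boo.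
  by move: tik'; rewrite Boo gt0_muley ?lte_fin// addey.
by split=> //; move: tik'; rewrite (mulE _ Bfin) -EFinD lee_fin.
Qed.

End tikhonov_minimizer.

(** * Convergence rate from the source condition *)

Theorem theorem3p2 (R : realType) (d : nat)
    (leb : {measure set (Rn R d) -> \bar R}) (lebP : is_lebesgue leb)
    (Omega : set (Rn R d)) (mOmega : measurable Omega)
    (W : wavelet_basis leb mOmega)
    (sD pD sG pG sS pS sR pR sigma : R)
    (pD_gt1 : 1 < pD) (pG_gt0 : 0 < pG) (pS_gt0 : 0 < pS) (pS_le_pG : pS <= pG)
    (pRE : pR = (pS + pG) / pG)
    (sR_le : sR <= (pS * sS - pG * sG) / (pS + pG))
    (sigmaE : sigma = sR + d%:R * (2^-1 - pR^-1))
    (* the wavelets characterize all the spaces that occur *)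
    (charD : characterizes W sD pD) (charD' : characterizes W (- sD) (conj_exp pD))
    (charG : characterizes W sG pG) (charS : characterizes W sS pS)
    (charR : characterizes W sR pR) (charH : characterizes W sigma 2)
    (F : dist W -> L2 leb mOmega)
    (F_linear : linear_on_besov sD pD F)
    (F_continuous : continuous_on_besov sD pD F)
    (rgF : adjoint_range sD pD F = besov W sG pG)
    (G_embedded : besov_embedded W sG pG (- sD) (conj_exp pD))
    (S_embedded : besov_embedded W sS pS sD pD)
    (v : L2 leb mOmega) (udag : dist W)
    (Fudag : L2eq (F udag) v) (udagS : besov W sS pS udag)
    (* the data, the parameter choice and the minimizers, indexed by delta *)
    (vdelta : R -> L2 leb mOmega)
    (vdelta_close : forall delta, 0 < delta ->
       (L2norm (v - vdelta delta) <= delta%:E)%E)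
    (alpha : R -> R)
    (alpha_gt0 : forall delta, 0 < delta -> 0 < alpha delta)
    (alpha_asymp : exists c C : R, [/\ 0 < c, 0 < C &
       forall delta, 0 < delta -> c * delta <= alpha delta <= C * delta])
    (umin : R -> dist W)
    (umin_min : forall delta, 0 < delta ->
       is_minimizer_on (besov W sD pD)
         (tikhonov F (vdelta delta) (alpha delta) sR pR) (umin delta)) :
  exists C : R, \forall delta \near 0^'+,
    (sobolev_norm sigma (umin delta - udag) <= (C * Num.sqrt delta)%:E)%E.
Proof.
have pD0 : 0 < pD by rewrite (lt_trans ltr01).
have pR12 : 1 < pR <= 2.
  rewrite pRE ltr_pdivlMr// ler_pdivrMr//; lra.
have /andP[pR1 pR2] := pR12; have pR0 : 0 < pR by rewrite (lt_trans ltr01).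
have udagD : besov W sD pD udag.
  have [K /(_ udag udagS) /le_lt_trans] := S_embedded; apply.
  (* The embedding constant comes without a sign; a negative one makes the bound nonpositive. *)
  have [K0|K0] := leP 0 K; first by rewrite lte_mul_pinfty.
  by rewrite (le_lt_trans _ (ltry 0))// mule_le0_ge0 ?lee_fin ?(ltW K0)// poweR_ge0.
have [xi xiG xiE] := besov_penalty_gradient pG_gt0 pS_gt0 pRE sR_le charG udagS.
(* The source element [w], whose image under the adjoint is the penalty gradient [xi]. *)
have [w [xiD xiF]] : adjoint_range sD pD F xi by rewrite rgF.
have Afin := besov_sum_gradient_fin pD_gt1 (ltW pR1) xiD udagD xiE.
have [c [C [c0 C0 aB]]] := alpha_asymp.
set A := fine (besov_sum sR pR (coef udag)).
set om := fine (L2norm w).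
(* Bounds the penalty of every minimizer with [delta <= 1]: minimality gives
   [alpha B <= delta^2 + alpha A], and [delta^2 <= delta <= alpha / c]. Its root [M] then bounds
   each rescaled coefficient, uniformly in [delta]. *)
pose N := A + c^-1.
have A0 : 0 <= A by rewrite fine_ge0// besov_sum_ge0.
have N0 : 0 < N by rewrite ltr_wpDl// invr_gt0.
pose M := N `^ pR^-1.
have M0 : 0 < M by rewrite powR_gt0.
pose K := 2^-1 * (pR - 1) * M `^ (pR - 2).
have K0 : 0 < K by rewrite !mulr_gt0 ?powR_gt0 ?invr_gt0// subr_gt0.
pose C' := c^-1 + om + C * om ^+ 2 / 4.
have C'0 : 0 <= C'.
  have om0 : 0 <= om by rewrite fine_ge0// Lnorm_ge0.
  by rewrite !addr_ge0 ?invr_ge0 ?(ltW c0)// divr_ge0// mulr_ge0 ?sqr_ge0// ltW.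
(* The squared error times [K] will be at most [C' delta]. *)
exists (Num.sqrt (C' / K)).
near=> delta.
have d0 : 0 < delta by near: delta; exact: nbhs_right_gt.
have d1 : delta <= 1 by near: delta; exact: nbhs_right_le.
have [Bfin tik] := L2norm_minimizer_le (lt0r_neq0 pR0) (alpha_gt0 _ d0) udagD Fudag
  (vdelta_close _ d0) Afin (umin_min _ d0).
have [umD _] := umin_min _ d0.
have /andP[ca aC] := aB _ d0.
set um := umin delta in Bfin tik umD *; set t := fine (L2norm _) in tik.
set B := fine (besov_sum sR pR (coef um)) in tik.
have eD : besov W sD pD (um - udag) by exact: besovB.
pose x l := besov_weight sR pR l * coef udag l.
pose y l := besov_weight sR pR l * coef um l.
have B_le : B <= N.
  have a0 := alpha_gt0 _ d0; rewrite -(ler_pM2l a0) /N mulrDr.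
  have h : delta <= alpha delta / c by rewrite ler_pdivlMr// mulrC.
  have h2 : delta ^+ 2 <= delta by rewrite expr2 ler_piMr// ltW.
  have := sqr_ge0 t; rewrite -/A in tik; lra.
have boundM (u : dist W) : besov_sum sR pR (coef u) \is a fin_num ->
    fine (besov_sum sR pR (coef u)) <= N ->
    forall l, `|besov_weight sR pR l * coef u l| <= M.
  move=> ufin uN l; apply: ler_powR_root => //.
  rewrite -lee_fin fineK// in uN.
  exact: (ler_esum_term (a := fun l => `|besov_weight sR pR l * coef u l| `^ pR)) uN.
have xM : forall l, `|x l| <= M.
  by apply: boundM => //; rewrite -/A /N lerDl invr_ge0 ltW.
have yM : forall l, `|y l| <= M by exact: boundM.
have [Tp Tn TE] := fin_duality pD_gt1 xiD eD.
pose T l := (coef xi l * coef (um - udag) l)%:E.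
(* The weight in [xi] moves onto the difference of coefficients, turning the duality pairing into
   the linear term of the Bregman distance. *)
have TxiE l :
    T l = (pR * `|x l| `^ (pR - 1) * Num.sg (x l) * (y l - x l))%:E.
  by rewrite /T xiE coefB /x /y /=; congr EFin; ring.
have breg := bregman_esum pR12 M0 xM yM TxiE.
rewrite -/K TE in breg.
set S := (\esum_(l in _) (`|y l - x l| `^ 2)%:E) in breg.
have S0 : (0 <= S)%E by apply: esum_ge0 => l _; rewrite lee_fin powR_ge0.
have tau_le : `|duality xi (um - udag)| <= (t + delta) * om.
  rewrite -(xiF _ eD).
  have Fe : L2eq (F (um - udag)) (F um - v).
    have := F_linear (-1) _ _ udagD umD; rewrite scaleN1r addrC /L2eq => Fl.
    move: Fudag Fl; rewrite /L2eq; apply: filterS2 => z e ->.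
    by rewrite L2_combE L2_subE e; ring.
  apply: (le_trans (L2inner_cauchy_schwarz _ _)).
  rewrite ler_wpM2r ?fine_ge0 ?Lnorm_ge0// (L2norm_congr Fe).
  rewrite -lee_fin [leRHS]EFinD /t !fineK ?fin_L2norm//.
  (* The image of the error is split at the noisy data: residual [t] plus noise level [delta]. *)
  by apply: (le_trans (ler_L2norm_subl _ (vdelta delta) _));
  rewrite leeD2l// vdelta_close.
set tau := duality _ _ in breg tau_le.
have AE : (\esum_(l in [set: windex W]) (`|x l| `^ pR)%:E = A%:E)%E.
  by rewrite /A fineK.
have BE : (\esum_(l in [set: windex W]) (`|y l| `^ pR)%:E = B%:E)%E.
  by rewrite /B fineK.
(* The sum of negative parts is finite and cancels, leaving [K S + A + tau <= B]; this also forces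
   [S] to be finite. *)
rewrite AE BE addeA leeD2rE// in breg.
have Sfin : S \is a fin_num.
  rewrite ge0_fin_numE// ltey; apply/eqP => Soo.
  by move: breg; rewrite Soo gt0_muley ?lte_fin// !addye.
have est : K * fine S <= C' * delta.
  apply: (tikhonov_estimate (t := t) (tau := tau) (A := A) (B := B)
    (a := alpha delta) (c := c)) => //.
  - by rewrite d0.
  - by rewrite ca.
  - by move: breg; rewrite -(fineK Sfin) -EFinM -!EFinD lee_fin.
rewrite (sobolev_normE _ sigmaE).
have -> : (\esum_(l in [set: windex W])
    (`|besov_weight sR pR l * coef (um - udag) l| `^ 2)%:E)%E = (fine S)%:E.
  by rewrite fineK//; apply: eq_esum => l _; rewrite coefB mulrBr.
rewrite poweR_EFin lee_fin powR12_sqrt ?fine_ge0// -sqrtrM; last first.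
  by rewrite divr_ge0// ltW.
rewrite ler_sqrt; last by rewrite mulr_ge0 ?divr_ge0// ltW.
by rewrite mulrAC ler_pdivlMr// mulrC.
Unshelve. all: by end_near. Qed.
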